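(* Let $p$ be a prime number and let $\mathscr{H}_p$ be the family of subgroups of the product $G=\mathbb{Z}(p)^{\mathbb{N}}$ which are uniformly controllable in $G$ but not strongly controllable in $G$. Then $|\mathscr{H}_p|=2^{\mathfrak{c}}$.
   Context: $\mathbb{Z}(p)$ is the cyclic group of order $p$, $\mathfrak{c}$ is the cardinality of the continuum, and $\mathbb{N}=\{0,1,2,\dots\}$. Let $\{G_i:i\in\mathbb{N}\}$ be a family of groups and $G=\prod_{i\in\mathbb{N}}G_i$. For $K\subseteq\mathbb{N}$, $\bigoplus_{i\in K}G_i$ denotes the subgroup of $G$ consisting of all $g\in G$ such that $g(i)$ is the identity of $G_i$ for all but finitely many $i\in\mathbb{N}$ and for every $i\in\mathbb{N}\setminus K$; for $J\subseteq \mathbb{N}$, $p_{\mathbb{N}J}:G\to\prod_{j\in J}G_j$ is the projection $g\mapsto g\restriction_J$. A subgroup $H$ of $G$ is uniformly controllable in $G$ if for every finite set $J\subseteq\mathbb{N}$ there exists a finite set $K\subseteq\mathbb{N}$ such that $p_{\mathbb{N}J}(H)=p_{\mathbb{N}J}(H\cap\bigoplus_{i\in K}G_i)$. For $k\in\mathbb{N}$, $H$ is $k$-controllable in $G$ if for each pair $h,h'\in H$ and every $n\in\mathbb{N}$ there exists $g\in H$ such that $g(i)=h(i)$ for all $i\in\mathbb{N}$ with $i\le n$ and $g(i)=h'(i)$ for all $i\in\mathbb{N}$ with $i\ge n+k$. $H$ is strongly controllable in $G$ if it is $k$-controllable in $G$ for some $k\in\mathbb{N}$. *)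

(* Defs.v *)
From HB Require Import structures.
From mathcomp Require Import all_boot all_order all_algebra.
From mathcomp Require Import all_classical all_reals.

Set Implicit Arguments.
Unset Strict Implicit.
Unset Printing Implicit Defensive.

Local Open Scope classical_set_scope.
Local Open Scope group_scope.

(* The unrestricted product of a countable family of groups.  It is a constant,
   rather than a bare product type, so that it can carry the pointwise group
   structure. *)
Definition prodg (G : nat -> groupType) : Type := forall i, G i.

Section ProductGroup.
Variable G : nat -> groupType.
Implicit Types x y z : prodg G.

Let one : prodg G := fun=> 1.
Let inv x : prodg G := fun i => (x i)^-1.
Let mul x y : prodg G := fun i => x i * y i.

Let mulA : associative mul.
Proof. by move=> x y z; apply: functional_extensionality_dep => i; exact: mulgA. Qed.
Let mul1 : left_id one mul.
Proof. by move=> x; apply: functional_extensionality_dep => i; exact: mul1g. Qed.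
Let mulr1 : right_id one mul.
Proof. by move=> x; apply: functional_extensionality_dep => i; exact: mulg1. Qed.
Let mulV : left_inverse one inv mul.
Proof. by move=> x; apply: functional_extensionality_dep => i; exact: mulVg. Qed.
Let mulrV : right_inverse one inv mul.
Proof. by move=> x; apply: functional_extensionality_dep => i; exact: mulgV. Qed.

HB.instance Definition _ := Choice.copy (prodg G) (forall i, G i).
HB.instance Definition _ := isGroup.Build (prodg G) mulA mul1 mulr1 mulV mulrV.

End ProductGroup.

Definition restr_to (G : nat -> groupType) (J : set nat) (g : prodg G) :
  forall j : J, G (set_val j) := fun j => g (set_val j).
Arguments restr_to {G} J g j.

Section Controllability.
Variable G : nat -> groupType.
Implicit Types (H : set (prodg G)) (J K : set nat).

Definition is_subgroup H : Prop := group_closed [in H].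

Definition dsum K : set (prodg G) :=
  [set g | finite_set [set i | g i <> 1] /\ forall i, ~ K i -> g i = 1].

Definition uniformly_controllable H : Prop :=
  forall J, finite_set J -> exists2 K, finite_set K &
    restr_to J @` H = restr_to J @` (H `&` dsum K).

Definition controllable (k : nat) H : Prop :=
  forall h h', H h -> H h' -> forall n : nat, exists2 g, H g &
    (forall i, (i <= n)%N -> g i = h i) /\
    (forall i, (n + k <= i)%N -> g i = h' i).

Definition strongly_controllable H : Prop := exists k, controllable k H.

End Controllability.

(* Z(p): on 'Z_p the operations of group_scope are those of the additive group,
   which is cyclic of order p as soon as p > 1. *)
Definition Zp_factor (p : nat) : nat -> groupType := fun=> 'Z_p.

Definition Hfam (p : nat) : set (set (prodg (Zp_factor p))) :=
  [set H | [/\ is_subgroup H, uniformly_controllable H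
             & ~ strongly_controllable H]].
Arguments Hfam p H : clear implicits.

(* Main.v *)
Require Import Defs.
From mathcomp Require Import all_boot all_order all_algebra.
From mathcomp Require Import all_classical all_reals.
From mathcomp Require Import zify lra.

Set Implicit Arguments.
Unset Strict Implicit.
Unset Printing Implicit Defensive.

Import Order.TTheory GRing.Theory Num.Theory.

Local Open Scope card_scope.
Local Open Scope classical_set_scope.

(** At most continuum many elements lie in the product: reading an element as a
    sequence of digits in a sufficiently large base embeds it in the reals
    ([expansion_injective]), so there are at most as many subgroups as sets of
    reals.

    For the converse, cut the index set into the dyadic blocks
    [2 ^ k, 2 ^ k.+1) and consider only elements constant on each block; these
    form a copy of the product itself, one coordinate per block.  Let [H] be a
    subgroup of that copy.  If [H] contains the elements that live on one block,
    it is not strongly controllable, since blocks are arbitrarily long and the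
    value at the beginning of a block determines the one at its end
    ([spread_not_strongly_controllable]).  If [H] is stable under replacing an
    element by the identity on all but finitely many blocks, it is uniformly
    controllable, since blocks are finite ([spread_uniformly_controllable]).

    It remains to find many such subgroups.  The reals index an almost disjoint
    family of infinite sets [branch r] of natural numbers.  For each set [A] of
    reals, take the sequences that are eventually trivial along every branch
    indexed outside [A].  Every finitely supported sequence qualifies, while the
    sequence that is constantly [t != 1] on [branch r] and trivial elsewhere
    qualifies exactly when [r] is in [A] ([trivial_along_branch]).  Hence [A]
    can be read off from the subgroup, and Cantor-Bernstein concludes. *)

Lemma finite_nat_bounded (D : set nat) :
  finite_set D -> exists N, forall n, D n -> (n < N)%N.
Proof.
move=> /finite_seqP[s ->]; exists (\max_(i <- s) i).+1 => n /= ns.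
by rewrite ltnS; exact: (@leq_bigmax_seq _ s xpredT id n ns).
Qed.

(** * An almost disjoint family of sets of natural numbers indexed by the reals *)

Section Branches.
Variable R : realType.

(** The index [n] is part of the code, so that two branches can only meet at equal
    indices; there the integer parts of [r * n] and [s * n] must agree. *)
Definition branch (r : R) (n : nat) : nat :=
  pickle (n, Num.floor (r * n%:R)%R).

Lemma branch_injective r : injective (branch r).
Proof. by move=> m n /(pcan_inj pickleK)[]. Qed.

(** Equal integer parts force [`|r - s| * n < 1], which fails for large [n]. *)
Lemma branch_almost_disjoint (r s : R) : r <> s ->
  exists N, forall m n, (N <= n)%N -> branch r m <> branch s n.
Proof.
move=> /eqP rs; have d0 : (0 < `|r - s|)%R by rewrite normr_gt0 subr_eq0.
pose N := Num.Def.archi_bound (`|r - s|^-1)%R; exists N => m n Nn.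
move=> /(pcan_inj pickleK)[-> {m} E].
have : (`|r - s| * n%:R < 1)%R.
  rewrite -[X in (_ * X)%R]ger0_norm ?ler0n// -normrM mulrBl ltr_norml.
  have /andP[] := floor_itv (r * n%:R)%R; have /andP[] := floor_itv (s * n%:R)%R.
  by rewrite E intrD; set f := (_%:~R)%R => *; apply/andP; split; lra.
rewrite -ltr_pdivlMl// mulr1 ltNge => /negP; apply.
apply: (le_trans (ltW (archi_boundP _))); first by rewrite invr_ge0.
by rewrite ler_nat.
Qed.

End Branches.

(** * Subgroups of elements constant on dyadic blocks *)

Section BlockConstant.
Variable T : groupType.
Local Open Scope group_scope.

(** The fibres of [trunc_log 2] are the dyadic blocks, except that [0] joins the
    block of [1].  Only two features matter: fibres are finite, and their
    diameters are unbounded. *)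
Definition spread (y : nat -> T) : prodg (fun=> T) := fun i => y (trunc_log 2 i).

Lemma spread_eq y z (h : spread y = spread z) : y = z.
Proof.
apply/funext => k; have := congr1 (fun g : prodg (fun=> T) => g (2 ^ k)%N) h.
by rewrite /spread trunc_expnK.
Qed.

(** To approximate an element on a finite [J], keep its values on the blocks that
    meet [J] and cut off the rest; the support lies in the union of these
    finitely many finite blocks. *)
Lemma spread_uniformly_controllable (Y : set (nat -> T)) :
  (forall D y, finite_set D -> Y y -> Y (fun k => if k \in D then y k else 1)) ->
  uniformly_controllable (spread @` Y).
Proof.
move=> Ycut J finJ; pose D := trunc_log 2 @` J.
have finD : finite_set D by exact: finite_image.
have [N DN] := finite_nat_bounded finD.
have finK : finite_set (trunc_log 2 @^-1` D).
  apply: (sub_finite_set _ (finite_II (2 ^ N))) => i /= /DN iN.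
  by apply: leq_trans (trunc_log_ltn i (isT : 1 < 2)%N) _; rewrite leq_exp2l.
exists (trunc_log 2 @^-1` D) => //; apply/seteqP; split; last first.
  by move=> _ [g [Hg _] <-]; exists g.
move=> _ [_ [y Yy <-] <-].
exists (spread (fun k => if k \in D then y k else 1)).
  split; first by exists (fun k => if k \in D then y k else 1) => //; exact: Ycut.
  rewrite /spread; split; last first.
    by move=> i /= Di; rewrite memNset.
  apply: sub_finite_set finK => i /=; apply: contra_notP => Di.
  by rewrite memNset.
apply/functional_extensionality_dep => j; rewrite /restr_to /spread mem_set//.
by exists (set_val j) => //; exact: set_valP.
Qed.

(** Interpolate between the element equal to [t] on block [k] and the identity,
    with [n] the first point of that block.  The block has [2 ^ k > k] points, so
    at its last point the interpolant must already be trivial, although it takes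
    the value [t] at its first point. *)
Lemma spread_not_strongly_controllable (Y : set (nat -> T)) (t : T) : t <> 1 ->
  Y (fun=> 1) -> (forall k, Y (fun n => if n == k then t else 1)) ->
  ~ strongly_controllable (spread @` Y).
Proof.
move=> t1 Y1 Yt [k ctrl].
have [_ [y _ <-] [gt g1]] := ctrl _ _ (imageP spread (Yt k))
  (imageP spread Y1) (2 ^ k)%N.
apply: t1; have := gt _ (leqnn _); rewrite /spread trunc_expnK// eqxx => <-.
have k2 : (2 ^ k + k <= (2 ^ k.+1).-1)%N.
  by have := ltn_expl k (isT : 1 < 2)%N; rewrite expnS; lia.
have := g1 _ k2; rewrite /spread => <-; congr y; symmetry.
apply: trunc_log_eq => //; rewrite prednK ?expn_gt0// leqnn andbT.
by apply: leq_trans k2; exact: leq_addr.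
Qed.

End BlockConstant.

(** * One subgroup for each set of reals *)

Section ManySubgroups.
Variables (R : realType) (T : groupType).
Local Open Scope group_scope.

Definition trivial_along (A : set R) : set (nat -> T) :=
  [set y | forall r, ~ A r -> exists N, forall n, (N <= n)%N -> y (branch r n) = 1].

Lemma trivial_along_finite A (D : set nat) (y : nat -> T) :
  finite_set D -> trivial_along A (fun k => if k \in D then y k else 1).
Proof.
move=> finD r _.
have [|N DN] := @finite_nat_bounded (branch r @^-1` D).
  by apply: finite_preimage finD => m n _ _; exact: branch_injective.
exists N => n Nn; case: ifPn => // /set_mem /DN.
by rewrite ltnNge Nn.
Qed.

Lemma trivial_along_subgroup A : is_subgroup (@spread T @` trivial_along A).
Proof.
split.
  by apply/mem_set; exists (fun=> 1) => // r _; exists 0%N.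
move=> _ _ /set_mem[y Hy <-] /set_mem[z Hz <-]; apply/mem_set.
exists (fun n => y n / z n) => // r /[dup] /Hy[M yM] /Hz[N zN].
exists (maxn M N) => n; rewrite geq_max => /andP[Mn Nn].
by rewrite yM// zN// divg1.
Qed.

(** If [r] is outside [A], the sequence is [t] on all of [branch r], against the
    definition; if [r] is in [A], every branch to be tested is different from
    [branch r] and so meets it in a finite set. *)
Lemma trivial_along_branch A (t : T) (r : R) : t <> 1 ->
  trivial_along A (fun k => if k \in range (branch r) then t else 1) <-> A r.
Proof.
move=> t1; split => [/(_ r) H|Ar s As].
  apply: contrapT => /H[N /(_ _ (leqnn N))].
  by rewrite mem_set.
have rs : r <> s by move=> rs; apply: As; rewrite -rs.
have [N HN] := branch_almost_disjoint rs; exists N => n Nn.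
by rewrite memNset// => -[m _ /HN]; exact.
Qed.

(** The surjection onto sets of reals recovers [A] as the set of those [r] for
    which the sequence supported on [branch r] belongs to the subgroup. *)
Lemma card_ge_controllable (t : T) : t <> 1 ->
  [set: set R] #<= [set H : set (prodg (fun=> T)) |
    [/\ is_subgroup H, uniformly_controllable H & ~ strongly_controllable H]].
Proof.
move=> t1; apply/pcard_surjP.
exists (fun H => [set r | H (spread (fun k => if k \in range (branch r) then t else 1))]).
move=> A _; exists (@spread T @` trivial_along A).
  split; first exact: trivial_along_subgroup.
    by apply: spread_uniformly_controllable => D y finD _; exact: trivial_along_finite.
  apply: (@spread_not_strongly_controllable _ _ t) => //.
    by move=> r _; exists 0%N.
  move=> k; have := @trivial_along_finite A _ (fun=> t) (finite_set1 k).
  by congr (trivial_along _ _); apply/funext => n; rewrite in_set1.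
apply/seteqP; split => r /=.
  by move=> [y Hy /spread_eq yE]; apply/(trivial_along_branch A r t1); rewrite -yE.
by move=> /(trivial_along_branch A r t1) H; exists (fun k => if k \in range (branch r) then t else 1).
Qed.

End ManySubgroups.

(** * Embedding digit sequences in the real line *)

Section Expansion.
Variables (R : realType) (b : nat).
Hypothesis b_gt0 : (0 < b)%N.
Local Open Scope ring_scope.
Implicit Types d e : nat -> 'I_b.

Let w (n : nat) : R := (2 * b)%:R ^- n.

Let w_gt0 n : 0 < w n.
Proof. by rewrite invr_gt0 exprn_gt0// ltr0n muln_gt0 b_gt0. Qed.

Let wS n : w n = w n.+1 * b%:R * 2.
Proof.
rewrite /w exprS invfM -[RHS]mulrA -natrM (mulnC b) mulrAC mulVf ?mul1r//.
by rewrite pnatr_eq0 muln_eq0 negb_or/= -lt0n.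
Qed.

(** Digits are below [b] but the base is [2 * b]: the gap keeps two
    different digit sequences from expanding to the same number. *)
Definition partial_expansion d n : R := \sum_(i < n) (d i)%:R * (2 * b)%:R ^- i.

Definition expansion d : R := sup (range (partial_expansion d)).

Lemma partial_expansionS d n :
  partial_expansion d n.+1 = partial_expansion d n + (d n)%:R * w n.
Proof. by rewrite /partial_expansion big_ord_recr. Qed.

(** Partial sums increase with [n], but decrease once the slack [b * (2 b) ^- n] is
    added: a digit plus half a unit is at most [b]. *)
Lemma partial_expansion_bound d m n :
  partial_expansion d n <= partial_expansion d m + b%:R * w m.
Proof.
pose u k := partial_expansion d k + b%:R * w k.
have up : {homo partial_expansion d : i j / (i <= j)%N >-> i <= j}.
  apply: homo_leq => // [x y z|k]; first exact: le_trans.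
  by rewrite partial_expansionS lerDl mulr_ge0// ltW.
have down : {homo u : i j / (i <= j)%N >-> j <= i}.
  apply: homo_leq => // [x y z yx zy|k]; first exact: le_trans zy yx.
  (* Multiplied by the weight at k, this pays for the slack at k.+1, which is
     half of that weight. *)
  have dk : (d k)%:R + 1 <= b%:R :> R by rewrite natr1 ler_nat.
  have := ler_wpM2r (ltW (w_gt0 k)) dk.
  by rewrite /u partial_expansionS; have := wS k; have := w_gt0 k; lra.
apply: le_trans (up _ _ (leq_maxr m n)) (le_trans _ (down _ _ (leq_maxl m n))).
by rewrite lerDl mulr_ge0// ltW.
Qed.

Lemma partial_expansion_le d n : partial_expansion d n <= expansion d.
Proof.
apply: ub_le_sup; last by exists n.
exists (partial_expansion d 0 + b%:R * w 0) => _ [k _ <-].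
exact: partial_expansion_bound.
Qed.

Lemma expansion_le d n :
  expansion d <= partial_expansion d n + b%:R * w n.
Proof.
apply: ge_sup; first by exists (partial_expansion d 0); exists 0%N.
by move=> _ [k _ <-]; exact: partial_expansion_bound.
Qed.

(** At the first difference [m], the partial sums differ by at least the weight
    [(2 b) ^- m], while everything after [m] contributes at most half of it. *)
Lemma expansion_lt d e m : (forall i, (i < m)%N -> d i = e i) ->
  (d m < e m)%N -> expansion d < expansion e.
Proof.
move=> dei dem.
apply: le_lt_trans (expansion_le d m.+1) _.
apply: lt_le_trans (partial_expansion_le e m.+1).
have -> : partial_expansion d m.+1 = partial_expansion e m + (d m)%:R * w m.
  rewrite partial_expansionS; congr (_ + _).
  by apply: eq_bigr => i _; rewrite dei.
rewrite partial_expansionS.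
have : (d m)%:R + 1 <= (e m)%:R :> R by rewrite natr1 ler_nat.
move=> /(ler_wpM2r (ltW (w_gt0 m))).
by have := wS m; have := w_gt0 m; lra.
Qed.

Lemma expansion_injective : injective expansion.
Proof.
move=> d e de; apply: contrapT => dNe.
have /ex_minnP[m dem mmin] : exists m, d m != e m.
  apply: contrapT => H; apply: dNe; apply/funext => i.
  by apply: contrapT => /eqP di; apply: H; exists i.
have agree i : (i < m)%N -> d i = e i.
  by move=> im; apply: contraTeq im => /mmin; rewrite -leqNgt.
have [lt|lt|/val_inj E] := ltngtP (d m) (e m).
- by have := expansion_lt agree lt; rewrite de ltxx.
- have agree' i : (i < m)%N -> e i = d i by move=> /agree.
  by have := expansion_lt agree' lt; rewrite de ltxx.
- by rewrite E eqxx in dem.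
Qed.

End Expansion.

(* |Hfam p| = 2^c, where 2^c is the cardinality of the power set of the reals. *)
Theorem theorem7p3 (R : realType) (p : nat) (hp : prime p) :
  Hfam p #= [set: set R].
Proof.
apply: Cantor_Bernstein; last first.
  apply: (@card_ge_controllable R 'Z_p (1%R : 'Z_p)).
  exact/eqP/oner_neq0.
pose f : prodg (Zp_factor p) -> R := @expansion R (Zp_trunc p).+2.
have f_inj : injective f by exact: (@expansion_injective R (Zp_trunc p).+2 isT).
apply/pcard_injP; exists (fun H => f @` H) => H K _ _ HK.
by apply/seteqP; split => d; rewrite -!(image_inj f_inj) HK.
Qed.
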